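(* Let $(D,\mathfrak S)$ be a crude linear series of rank $r$ on a metric graph $\Gamma$. Let $G=(V,E)$ be a model of $\Gamma$ such that $D$ is supported on $V$, and let $e=uv$ be an oriented edge of $G$. For each point $x$ on $e$ other than its head $v$, let $\nu$ denote the unit tangent vector at $x$ pointing along $e$ in the direction of its orientation, and let $s_0^\nu(x)<\dots<s_r^\nu(x)$ be the elements of the set $S^\nu$ given by $\mathfrak S$ for the tangent vector $\nu$ at $x$. Then the vector-valued function $x\mapsto(s_0^\nu(x),\dots,s_r^\nu(x))$ is coordinatewise non-increasing along $e$: for every such $x$ and every sufficiently small $\varepsilon>0$, denoting by $y=x+\varepsilon\nu$ the point at distance $\varepsilon$ from $x$ in the direction $\nu$, one has $$s_j^\nu(y)\le s_j^\nu(x)\qquad\text{for every } j=0,1,\dots,r,$$ and consequently $s_j^\nu(y)\le s_j^\nu(x)$ whenever $x$ precedes $y$ on $e$.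
   Context: Metric graphs. A metric graph $\Gamma$ is the metric realization of a pair $(G,\ell)$, where $G=(V,E)$ is a finite connected graph with at least one edge and $\ell\colon E\to\mathbb R_{>0}$: each edge $e$ is replaced by a closed interval of length $\ell(e)$, glued according to $G$, with the path metric. $G$ (with $\ell$) is called a model of $\Gamma$; a model is simple if it has no loops and no parallel edges. $\mathrm T_x(\Gamma)$ is the finite set of outgoing unit tangent vectors at $x$, and $d_x=|\mathrm T_x(\Gamma)|$. $\mathrm{Rat}(\Gamma)$ is the set of continuous piecewise affine functions $f\colon\Gamma\to\mathbb R$ with integral slopes; $\mathrm{slope}_\nu(f)$ is the outgoing slope of $f$ along $\nu$. A divisor $D$ is a finite formal integer combination of points of $\Gamma$, $D(x)$ is its coefficient at $x$, $D\ge 0$ (effective) means all coefficients are $\geq 0$. $\mathrm{div}(f)=\sum_x \mathrm{ord}_x(f)(x)$ with $\mathrm{ord}_x(f)=-\sum_{\nu\in \mathrm T_x(\Gamma)}\mathrm{slope}_\nu(f)$. Hypercube rank functions. Put $[r]=\{0,\dots,r\}$. The hypercube $[r]^\delta$ ($\delta\geq 1$) carries the coordinatewise order $\preceq$ and coordinatewise max $\vee$ and min $\wedge$; $\underline e_i$ is the $i$-th unit vector. A rank function is a map $\rho\colon[r]^\delta\to\mathbb Z$ such that: (1) $\rho(t\,\underline e_i)=r-t$ for all $i$ and $t\in[r]$; (2) $\underline a\preceq\underline b$ implies $\rho(\underline b)\le\rho(\underline a)$; (3) $\rho(\underline a)+\rho(\underline b)\le\rho(\underline a\vee\underline b)+\rho(\underline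 a\wedge\underline b)$; (4) $\rho$ takes values in $\{-1,0,\dots,r\}$. A jump of $\rho$ is a point $\underline a$ with $\rho(\underline a)\ge 0$ and $\rho(\underline a+\underline e_i)=\rho(\underline a)-1$ for every $i$ with $\underline a+\underline e_i\in[r]^\delta$. The standard rank function is $\rho(\underline a)=\max\{-1,r-a_1-\dots-a_\delta\}$. Slope structures. A slope structure $\mathfrak S$ of width $r$ on $\Gamma$ is the data, on some simple graph model $H=(V',E')$ of $\Gamma$, of: for every oriented edge $uv$, a set $S^{uv}$ of integers $s_0^{uv}<\dots<s_r^{uv}$ with $s_i^{uv}+s_{r-i}^{vu}=0$; for every $v\in V'$, a rank function $\rho_v$ on $[r]^{d_v}$, whose coordinates are indexed by the oriented edges with tail $v$ (equivalently by $\mathrm T_v(\Gamma)$). It is extended to all of $\Gamma$: for $\nu\in \mathrm T_x(\Gamma)$, $S^\nu=\{s_0^\nu<\dots<s_r^\nu\}$ is $S^{uv}$ for the oriented edge $uv$ of $H$ parallel to $\nu$; for $x\in\Gamma\setminus V'$, $\rho_x$ is the standard rank function on $[r]^2$. For $\underline a=(a_\nu)_\nu\in[r]^{\mathrm T_x(\Gamma)}$ put $s_{\underline a}=(s^\nu_{a_\nu})_\nu$, and let $S^x=\{s_{\underline a}:\underline a\text{ a jump of }\rho_x\}$. A function $f\in\mathrm{Rat}(\Gamma)$ is compatible with $\mathfrak S$ if for every $x\in\Gamma$, $\mathrm{slope}_\nu(f)\in S^\nu$ for all $\nu\in\mathrm T_x(\Gamma)$, and $\partial_x(f):=(\mathrm{slope}_\nu(f))_{\nu\in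 \mathrm T_x(\Gamma)}\in S^x$. If $\partial_x(f)=s_{\underline a}$, write $\rho_x(\partial_x(f)):=\rho_x(\underline a)$. $\mathrm{Rat}(D,\mathfrak S)$ is the set of $f\in\mathrm{Rat}(\Gamma)$ compatible with $\mathfrak S$ with $D+\mathrm{div}(f)\ge0$. A crude linear series of rank $r$ is a pair $(D,\mathfrak S)$ with $D$ a divisor and $\mathfrak S$ a slope structure of width $r$ on $\Gamma$ such that for every effective divisor $E$ of degree $r$ there is $f\in\mathrm{Rat}(D,\mathfrak S)$ with $\rho_x(\partial_x(f))\ge E(x)$ for all $x\in\Gamma$ and $D+\mathrm{div}(f)-E\ge0$. *)

(* Defs.v *)
From HB Require Import structures.
From mathcomp Require Import all_boot all_order all_algebra finmap.
From mathcomp Require Import all_classical all_reals all_analysis.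

Set Implicit Arguments.
Unset Strict Implicit.
Unset Printing Implicit Defensive.

Import Order.TTheory GRing.Theory Num.Theory.
Import numFieldNormedType.Exports.

Local Open Scope classical_set_scope.
Local Open Scope ring_scope.

Definition adjacent (V E : finType) (src tgt : E -> V) : rel V :=
  fun u v => [exists e, ((src e == u) && (tgt e == v))
                     || ((src e == v) && (tgt e == u))].

(* A pair (G, l); loops and parallel edges are allowed.  The orientation given
   by [source] and [target] is an arbitrary reference orientation, used only to
   put a coordinate on each edge. *)
Record weighted_graph (R : realType) := WeightedGraph {
  vertex : finType;
  edge : finType;
  source : edge -> vertex;
  target : edge -> vertex;
  len : edge -> R;
  len_gt0 : forall e, 0 < len e;
  edge_gt0 : (0 < #|edge|)%N;
  graph_connected : forall u v, connect (adjacent source target) u v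
}.

Section Realization.
Variables (R : realType) (G : weighted_graph R).

(* Oriented edges; the boolean is [true] for the reference orientation. *)
Definition dart : Type := (edge G * bool)%type.
Definition dtail (d : dart) : vertex G :=
  if d.2 then source d.1 else target d.1.
Definition dhead (d : dart) : vertex G :=
  if d.2 then target d.1 else source d.1.
Definition drev (d : dart) : dart := (d.1, ~~ d.2).
Definition dlen (d : dart) : R := len d.1.

Definition simple_graph : Prop :=
  (forall e : edge G, source e != target e) /\
  (forall e e' : edge G, e != e' ->
     [set source e; target e]%SET != [set source e'; target e']%SET).

(* Points of the realization, in normal form: a vertex, or an edge together
   with a coordinate strictly between its ends, measured from the source. *)
Definition realization : Type :=
  (vertex G + {e : edge G & {t : R | 0 < t < len e}})%type.
HB.instance Definition _ := Choice.copy realization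
  (vertex G + {e : edge G & {t : R | 0 < t < len e}})%type.

(* The point at distance t from the tail of d, for 0 <= t <= dlen d; outside
   this range the coordinate is truncated. *)
Definition pt (d : dart) (t : R) : realization :=
  let c := if d.2 then t else len d.1 - t in
  if (insub c : option {t : R | 0 < t < len d.1}) is Some c'
  then inr (Tagged (fun e : edge G => {t : R | 0 < t < len e}) c')
  else inl (if t <= 0 then dtail d else dhead d).

Fixpoint edge_path (x : realization) (s : seq (dart * R * R))
    (y : realization) : Prop :=
  if s is (d, a, b) :: s' then
    [/\ 0 <= a <= dlen d, 0 <= b <= dlen d, pt d a = x
      & edge_path (pt d b) s' y]
  else x = y.

(* The path metric: infimum of the lengths of the chains of edge segments from
   x to y. *)
Definition pathdist (x y : realization) : R :=
  inf [set L | exists2 s, edge_path x s y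
                        & L = \sum_(p <- s) `|p.2 - p.1.2|].

(* A tangent vector at x is encoded by the oriented edge along which it leaves
   x: at a vertex, an oriented edge with this tail (so that a loop counts
   twice); inside an edge, one of the two orientations of this edge. *)
Definition leaves (x : realization) (d : dart) : bool :=
  match x with
  | inl v => dtail d == v
  | inr p => d.1 == tag p
  end.
Definition tangent (x : realization) : Type := {d : dart | leaves x d}.
HB.instance Definition _ (x : realization) :=
  Finite.copy (tangent x) {d : dart | leaves x d}.

Definition position (x : realization) (d : dart) : R :=
  match x with
  | inl _ => 0
  | inr p => if d.2 then val (tagged p) else len (tag p) - val (tagged p)
  end.

(* The point x + s nu, for small s >= 0. *)
Definition move (x : realization) (nu : tangent x) (s : R) : realization :=
  pt (val nu) (position x (val nu) + s).

(* f is affine with integral slope on each closed segment whose interior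
   contains no breakpoint; as the segments are closed and f is a function on
   the glued space, this includes continuity. *)
Definition Rat (f : realization -> R) : Prop :=
  forall d : dart, exists breaks : seq R, forall a b : R,
    0 <= a -> a <= b -> b <= dlen d ->
    (forall c, c \in breaks -> ~~ (a < c < b)) ->
    exists k : int, forall t, a <= t <= b ->
      f (pt d t) = f (pt d a) + k%:~R * (t - a).

(* The outgoing slope; for f in Rat exactly one integer has the property. *)
Definition slope (f : realization -> R) (x : realization) (nu : tangent x) :
    int :=
  xget 0 [set k : int | \forall s \near (0 : R)^'+,
                          f (move nu s) = f x + k%:~R * s].

Definition divisor : Type := {fsfun realization -> int with 0}.
Definition effective (D : divisor) : Prop := forall x, 0 <= D x.
Definition degree (D : divisor) : int := \sum_(x <- finsupp D) D x.

(* The coefficient of div(f) at x. *)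
Definition div (f : realization -> R) (x : realization) : int :=
  - \sum_(nu : tangent x) slope f nu.

End Realization.

(* A model of the metric graph realizing Gamma: a weighted graph together with
   an isometry from its realization. *)
Record model (R : realType) (Gamma : weighted_graph R) := Model {
  model_graph :> weighted_graph R;
  to_graph : realization model_graph -> realization Gamma;
  of_graph : realization Gamma -> realization model_graph;
  to_graphK : cancel to_graph of_graph;
  of_graphK : cancel of_graph to_graph;
  to_graph_isometry : forall x y,
    pathdist (to_graph x) (to_graph y) = pathdist x y
}.

Definition parallel (R : realType) (Gamma : weighted_graph R)
    (H : model Gamma) (x : realization Gamma)
    (mu : tangent (of_graph H x)) (nu : tangent x) : Prop :=
  \forall s \near (0 : R)^'+, to_graph (move mu s) = move nu s.

(* [nu] points along the oriented edge [d] at its point of coordinate [t]. *)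
Definition points_along (R : realType) (Gamma : weighted_graph R)
    (G : model Gamma) (d : dart G) (t : R)
    (nu : tangent (to_graph (pt d t))) : Prop :=
  \forall s \near (0 : R)^'+, to_graph (pt d (t + s)) = move nu s.

Section RankFunctions.
Variables (r : nat) (I : finType).

Implicit Types (a b : {ffun I -> 'I_r.+1}) (rho : {ffun I -> 'I_r.+1} -> int).

Definition axis (i : I) (t : 'I_r.+1) : {ffun I -> 'I_r.+1} :=
  [ffun j => if j == i then t else ord0].
Definition hle a b : Prop := forall i, (a i <= b i)%N.
Definition hjoin a b : {ffun I -> 'I_r.+1} :=
  [ffun i => if (a i <= b i)%N then b i else a i].
Definition hmeet a b : {ffun I -> 'I_r.+1} :=
  [ffun i => if (a i <= b i)%N then a i else b i].

Definition rank_function rho : Prop :=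
  [/\ forall (i : I) (t : 'I_r.+1), rho (axis i t) = r%:Z - t%:Z,
      forall a b, hle a b -> rho b <= rho a,
      forall a b, rho a + rho b <= rho (hjoin a b) + rho (hmeet a b)
    & forall a, -1 <= rho a <= r%:Z].

(* a + e_i, for a i < r. *)
Definition hsucc a (i : I) : {ffun I -> 'I_r.+1} :=
  [ffun j => if j == i then inord (a j).+1 else a j].

Definition jump rho a : Prop :=
  0 <= rho a /\ forall i, (a i < r)%N -> rho (hsucc a i) = rho a - 1.

Definition standard_rank a : int :=
  Num.max (-1) (r%:Z - \sum_i (a i)%:Z).

End RankFunctions.

Record slope_structure (R : realType) (Gamma : weighted_graph R) (r : nat) :=
  SlopeStructure {
    ss_model : model Gamma;
    ss_simple : simple_graph ss_model;
    ss_slope : dart ss_model -> 'I_r.+1 -> int;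
    ss_slope_incr : forall d (i j : 'I_r.+1),
      (i < j)%N -> ss_slope d i < ss_slope d j;
    ss_slope_rev : forall d i, ss_slope d i + ss_slope (drev d) (rev_ord i) = 0;
    ss_rank : forall v : vertex ss_model,
      {ffun tangent (inl v : realization ss_model) -> 'I_r.+1} -> int;
    ss_rankP : forall v, rank_function (@ss_rank v)
  }.

Section CrudeLinearSeries.
Variables (R : realType) (Gamma : weighted_graph R) (r : nat).
Implicit Types (f : realization Gamma -> R) (D : divisor Gamma).
Variable S : slope_structure Gamma r.
Local Notation H := (ss_model S).

(* s_i^nu.  As H and Gamma are isometric, exactly one tangent vector is
   parallel to nu, and the default value is never used. *)
Definition slope_at (x : realization Gamma) (nu : tangent x) (i : 'I_r.+1) :
    int :=
  if [pick mu : tangent (of_graph H x) | `[< parallel mu nu >]] is Some mu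
  then ss_slope (val mu) i else 0.

Definition model_rank (y : realization H) :
    {ffun tangent y -> 'I_r.+1} -> int :=
  match y with
  | inl v => @ss_rank _ _ _ S v
  | inr p => @standard_rank r (tangent (inr p : realization H))
  end.

(* rho_x on the hypercube indexed by T_x(Gamma), the coordinates being
   identified through [parallel]. *)
Definition rank_at (x : realization Gamma) (a : {ffun tangent x -> 'I_r.+1}) :
    int :=
  @model_rank (of_graph H x)
    [ffun mu => if [pick nu : tangent x | `[< parallel mu nu >]] is Some nu
                then a nu else ord0].

Definition slope_vector (x : realization Gamma)
    (a : {ffun tangent x -> 'I_r.+1}) : {ffun tangent x -> int} :=
  [ffun nu => slope_at nu (a nu)].

Definition allowed_vector (x : realization Gamma)
    (w : {ffun tangent x -> int}) : Prop :=
  exists2 a, jump (@rank_at x) a & w = slope_vector a.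

(* rho_x(w), for w = s_a; the vector a is unique when it exists. *)
Definition rank_of_vector (x : realization Gamma)
    (w : {ffun tangent x -> int}) : int :=
  if [pick a : {ffun tangent x -> 'I_r.+1} | slope_vector a == w] is Some a
  then rank_at a else -1.

Definition partial f (x : realization Gamma) : {ffun tangent x -> int} :=
  [ffun nu => slope f nu].

Definition compatible f : Prop :=
  forall x : realization Gamma,
    (forall nu : tangent x, exists i, slope f nu = slope_at nu i) /\
    allowed_vector (partial f x).

Definition RatDS D f : Prop :=
  [/\ Rat f, compatible f & forall x, 0 <= D x + div f x].

Definition crude_linear_series D : Prop :=
  forall E : divisor Gamma, effective E -> degree E = r%:Z ->
    exists2 f, RatDS D f &
      forall x, E x <= rank_of_vector (partial f x) /\
                0 <= D x + div f x - E x.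

End CrudeLinearSeries.

(* Main.v *)
Require Import Defs.
From mathcomp Require Import all_boot all_order all_algebra finmap.
From mathcomp Require Import all_classical all_reals all_analysis.
From mathcomp Require Import ring lra zify.
Import Order.TTheory GRing.Theory Num.Theory.
Import numFieldNormedType.Exports.
Local Open Scope classical_set_scope.
Local Open Scope ring_scope.

Set Implicit Arguments.
Unset Strict Implicit.
Unset Printing Implicit Defensive.

(** The slopes prescribed along [e] are those of the edges of the graph
    carrying the slope structure, so they are constant along [e] except where
    [e] crosses a vertex of that graph. To the right of such a crossing point
    x, and at x itself, they are s_0 < ... < s_r; on its left they are the
    negatives of the slopes s'_0 < ... < s'_r leaving x backwards, in reverse
    order. Monotonicity at x is thus the inequality s_j + s'_(r-j) <= 0
    ([opposite_slopes_le]).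

    To prove it, put j distinct points just to the right of x and r - j just
    to its left, and let f be a function of the series with D + div(f) >= E,
    where E is the sum of these r points ([section_through_spaced_points]).
    Inside [e] the divisor D is zero, so div(f) >= 0 there: moving along [e],
    the slope of f never increases, and it drops by at least 1 at each chosen
    point. Right of x all these slopes belong to {s_0, ..., s_r}; as j strict
    drops follow x, the slope of f leaving x forwards is some s_i with i >= j
    ([slope_index_ge]). By the same argument the slope leaving x backwards is
    some s'_i' with i' >= r - j. Finally div(f) >= 0 at x says s_i + s'_i' <=
    0, hence s_j + s'_(r-j) <= 0. A supremum argument
    ([locally_nonincreasing]) passes from monotonicity near each point to
    monotonicity along [e].

    The three graphs involved (the given one, the model containing [e], and
    the model carrying the slopes) are related only by isometries of their
    realizations. What makes the argument meaningful is that an isometry maps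
    a germ of segment at a point onto a germ of segment ([isometry_tangent]):
    a small sphere around x meets each branch once, and, at given distances
    from x, points on different branches are farther apart than points on the
    same branch. The lower bounds on the path metric that this uses come from
    explicit 1-Lipschitz functions ([lipschitz_le_pathdist]). *)

(** * Real functions near a point *)

Lemma near_right0P (R : realType) (P : R -> Prop) :
  (\forall s \near (0 : R)^'+, P s) <->
  exists2 delta, 0 < delta & forall s, 0 < s < delta -> P s.
Proof.
split.
- rewrite near_withinE => /nbhs_ballP[d /= d0 dP]; exists d => // s /andP[s0 sd].
  apply: dP => //=; rewrite /ball /= sub0r normrN gtr0_norm //.
- case=> d d0 dP; near=> s; apply: dP; apply/andP; split; near: s.
    exact: nbhs_right_gt.
  exact: nbhs_right_lt.
Unshelve. all: by end_near. Qed.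

(** Along [[t, t']], the points up to which [g] stays below [g t] form an
    interval; the condition from the left puts its supremum in it, and the
    condition from the right keeps this supremum from being smaller than [t'].
    No continuity is assumed, so a condition is required on each side. *)
Lemma locally_nonincreasing (R : realType) (L : R) (g : R -> int) :
  (forall t, 0 <= t < L -> \forall e \near (0 : R)^'+, g (t + e) <= g t) ->
  (forall t, 0 < t < L -> \forall e \near (0 : R)^'+, g t <= g (t - e)) ->
  forall t t', 0 <= t -> t <= t' -> t' < L -> g t' <= g t.
Proof.
move=> gr gl t t' t0 tt' t'L.
pose A : set R := [set s | t <= s <= t' /\ forall u, t <= u <= s -> g u <= g t].
have At : A t.
  split; first by rewrite lexx.
  by move=> u /andP[tu ut]; have -> : u = t by lra.
have ubA : has_ubound A by exists t' => s [/andP[]].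
have supA : has_sup A by split => //; exists t.
have tc : t <= sup A by apply: ub_le_sup.
have ct' : sup A <= t' by apply: ge_sup; [exists t | move=> s [/andP[]]].
have Ac : A (sup A).
  have [<-//|neq] := eqVneq t (sup A).
  have tltc : t < sup A by rewrite lt_neqAle neq.
  have /near_right0P[d d0 dP] : \forall e \near (0 : R)^'+, g (sup A) <= g (sup A - e).
    by apply: gl; lra.
  have below u : t <= u < sup A -> g u <= g t.
    move=> /andP[tu uc].
    have uc' : 0 < sup A - u by rewrite subr_gt0.
    have [s As us] := sup_adherent uc' supA.
    case: As => _; apply; lra.
  split; first by rewrite tc.
  move=> u /andP[tu]; rewrite le_eqVlt => /predU1P[->|uc]; last by apply: below; lra.
  pose e := Num.min (d / 2) (sup A - t).
  have e0 : 0 < e by rewrite /e lt_min; apply/andP; split; lra.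
  have ed : e <= d / 2 by rewrite /e ge_min lexx.
  have et : e <= sup A - t by rewrite /e ge_min lexx orbT.
  apply: (@le_trans _ _ (g (sup A - e))); first by apply: dP; lra.
  by apply: below; lra.
have [ceq|neq] := eqVneq (sup A) t'.
  by case: Ac => _; apply; rewrite ceq tt' lexx.
have cltt' : sup A < t' by rewrite lt_neqAle neq.
have /near_right0P[d d0 dP] : \forall e \near (0 : R)^'+, g (sup A + e) <= g (sup A).
  by apply: gr; lra.
pose e := Num.min (d / 2) (t' - sup A).
have e0 : 0 < e by rewrite /e lt_min; apply/andP; split; lra.
have ed : e <= d / 2 by rewrite /e ge_min lexx.
have et : e <= t' - sup A by rewrite /e ge_min lexx orbT.
have Ace : A (sup A + e).
  split; first lra.
  move=> u /andP[tu ue]; have [uc|uc] := leP u (sup A).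
    by case: Ac => _; apply; rewrite tu.
  apply: (@le_trans _ _ (g (sup A))); last by case: Ac => _; apply; rewrite tc lexx.
  have -> : u = sup A + (u - sup A) by lra.
  by apply: dP; lra.
by have := ub_le_sup ubA Ace; rewrite gerDl leNgt e0.
Qed.

(** Each strict descent among the values of an increasing family lowers the
    index by at least 1, so the index from which [n] descents start is at least
    [n]. *)
Lemma index_of_descent (r : nat) (sigma : 'I_r.+1 -> int) (v : nat -> int) n :
  (forall i j : 'I_r.+1, (i < j)%N -> sigma i < sigma j) ->
  (forall k, (k <= n)%N -> exists i, v k = sigma i) ->
  (forall k, (k < n)%N -> v k.+1 < v k) ->
  exists2 i, v 0%N = sigma i & (n <= i)%N.
Proof.
move=> incr; elim: n v => [|n IH] v vsig vdec.
  by have [i vi] := vsig 0%N isT; exists i.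
have [i vi ni] := IH (v \o succn) (fun k kn => vsig k.+1 kn) (fun k kn => vdec k.+1 kn).
have [j vj] := vsig 0%N isT; exists j => //.
have := vdec 0%N isT; rewrite vj -/((v \o succn) 0%N) vi => sij.
apply: leq_ltn_trans ni _; rewrite ltnNge; apply/negP; rewrite leq_eqVlt.
case/predU1P => [/val_inj ji|ji]; first by rewrite ji ltxx in sij.
by have := lt_trans sij (incr _ _ ji); rewrite ltxx.
Qed.

(** * Points of a dart *)

Section Darts.
Variables (R : realType) (G : weighted_graph R).
Implicit Types (d : dart G) (t : R) (x y : realization G).

(** Coordinate measured from the source of the edge; it is its own inverse, so it
    also converts back to the coordinate along the dart. *)
Definition dart_coord d t : R := if d.2 then t else len d.1 - t.

Lemma dart_coordK d : involutive (dart_coord d).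
Proof. by move=> t; rewrite /dart_coord; case: d.2; rewrite ?subKr. Qed.

Lemma drevK d : drev (drev d) = d.
Proof. by case: d => e b; rewrite /drev /= negbK. Qed.

Lemma dlen_gt0 d : 0 < dlen d. Proof. exact: len_gt0. Qed.

Lemma dart_eqVrev d d' : d.1 = d'.1 -> d' = d \/ d' = drev d.
Proof.
by case: d d' => [e []] [e' []] /= ->; rewrite /drev; [left|right|right|left].
Qed.

Lemma drev_neq d : drev d != d.
Proof. by case: d => e []; apply/eqP => -[]. Qed.

Lemma dart_coord_bnd d t : 0 < t < dlen d -> 0 < dart_coord d t < len d.1.
Proof. by rewrite /dart_coord /dlen; case: ifP => _; lra. Qed.

Lemma pt_inner d t (H : 0 < dart_coord d t < len d.1) :
  pt d t = inr (Tagged (fun e : edge G => {t : R | 0 < t < len e})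
                  (exist (fun s : R => 0 < s < len d.1) _ H)).
Proof. by rewrite /pt -/(dart_coord d t) insubT. Qed.

Lemma pt_tail d : pt d 0 = inl (dtail d).
Proof.
rewrite /pt -/(dart_coord d 0) insubN ?lexx // /dart_coord.
by case: ifP => _; apply/negP => /andP[]; rewrite ?subr0 ltxx.
Qed.

Lemma pt_head d : pt d (dlen d) = inl (dhead d).
Proof.
rewrite /pt -/(dart_coord d _) insubN ?leNgt ?dlen_gt0 // /dart_coord /dlen.
by case: ifP => _; apply/negP => /andP[]; rewrite ?subrr ltxx.
Qed.

Lemma pt_drev d t : 0 <= t <= dlen d -> pt (drev d) (dlen d - t) = pt d t.
Proof.
move=> /andP[t0 tl]; move: t0; rewrite le_eqVlt => /predU1P[<-|t0].
  rewrite subr0 (_ : dlen d = dlen (drev d)) // pt_head pt_tail.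
  by rewrite /dhead /dtail /=; case: d.2.
move: tl; rewrite le_eqVlt => /predU1P[->|tl].
  rewrite subrr pt_tail pt_head.
  by rewrite /dhead /dtail /=; case: d.2.
rewrite /pt /drev /dlen /=; case: d.2 => /=; rewrite ?subKr.
all: have dl : 0 < dlen d by exact: dlen_gt0.
all: rewrite /dlen in tl dl.
all: by case: insubP => // /negP[]; lra.
Qed.

Lemma pt_drevB d t : 0 <= t <= dlen d -> pt d (dlen d - t) = pt (drev d) t.
Proof. by move=> H; rewrite -{1}(drevK d) (_ : dlen d = dlen (drev d)) // pt_drev. Qed.

Lemma pt_inj d t d' t' : 0 < t < dlen d -> 0 < t' < dlen d' ->
  pt d t = pt d' t' -> d.1 = d'.1 /\ dart_coord d t = dart_coord d' t'.
Proof.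
move=> /dart_coord_bnd H /dart_coord_bnd H'.
rewrite (pt_inner H) (pt_inner H') => E.
pose edge_of (z : realization G) := if z is inr p then Some (tag p) else None.
pose coord_of (z : realization G) : R := if z is inr p then val (tagged p) else 0.
by split; [case: (congr1 edge_of E) | exact: (congr1 coord_of E)].
Qed.

(** Two darts that share a germ lie on the same edge, and they are not opposite
    to each other because the coordinate grows in the same direction. *)
Lemma dart_germ_inj d c d' c' : 0 <= c < dlen d -> 0 <= c' < dlen d' ->
  (\forall s \near (0 : R)^'+, pt d (c + s) = pt d' (c' + s)) -> d = d'.
Proof.
move=> cd cd' /near_right0P[w w0 wP].
pose m := Num.min w (Num.min (dlen d - c) (dlen d' - c')).
have m0 : 0 < m by rewrite /m !lt_min; apply/and3P; split; lra.
have mw : m <= w by rewrite /m ge_min lexx.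
have md : m <= dlen d - c by rewrite /m !ge_min lexx !orbT.
have md' : m <= dlen d' - c' by rewrite /m !ge_min lexx !orbT.
have small s : 0 < s < m ->
    d.1 = d'.1 /\ dart_coord d (c + s) = dart_coord d' (c' + s).
  by move=> sm; apply: pt_inj; [lra | lra | apply: wP; lra].
have [e1 c1] : _ /\ _ := small (m / 2) ltac:(lra).
have [_ c2] : _ /\ _ := small (m / 3) ltac:(lra).
have [//|] := dart_eqVrev e1 => dE.
exfalso; subst d'; move: c1 c2; rewrite /dart_coord /=; case: d.2 => /=; lra.
Qed.

Lemma realization_pt x : (exists v, x = inl v) \/
  exists (d : dart G) (t : R), 0 < t < dlen d /\ x = pt d t.
Proof.
case: x => [v|[e [t Ht]]]; [by left; exists v|right].
exists (e, true), t; split=> //; have H : 0 < dart_coord (e, true) t < len e by [].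
by rewrite (pt_inner (d := (e, true)) H) (bool_irrelevance H Ht).
Qed.

Lemma position_bnd x (nu : tangent x) :
  0 <= position x (val nu) < dlen (val nu).
Proof.
case: x nu => [v|[e [t Ht]]] [[e' b] /= H]; rewrite /dlen /= ?lexx ?len_gt0 //.
by move/eqP: H => ->; case: b; lra.
Qed.

Lemma pt_position x (nu : tangent x) : pt (val nu) (position x (val nu)) = x.
Proof.
case: x nu => [v|[e [t Ht]]] [[e' b] /= H].
  by rewrite pt_tail (eqP H).
move/eqP: H => ->.
have dc : dart_coord (e, b) (if b then t else len e - t) = t.
  by rewrite /dart_coord /=; case: b; rewrite ?subKr.
have H' : 0 < dart_coord (e, b) (if b then t else len e - t) < len e by rewrite dc.
rewrite (pt_inner (d := (e, b)) H'); congr (inr (existT _ e _)).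
exact: val_inj.
Qed.

Lemma pt_tangent d t : 0 <= t < dlen d ->
  exists2 nu : tangent (pt d t), val nu = d & position (pt d t) d = t.
Proof.
move=> /andP[t0 td].
have [L P] : leaves (pt d t) d /\ position (pt d t) d = t.
  move: t0; rewrite le_eqVlt => /predU1P[<-|t0]; first by rewrite pt_tail /= eqxx.
  have H : 0 < dart_coord d t < len d.1 by apply: dart_coord_bnd; rewrite t0.
  by rewrite (pt_inner H) /= eqxx; split=> //; apply: (dart_coordK d).
by exists (exist _ d L).
Qed.

Lemma tangent_germ_inj x (nu nu' : tangent x) :
  (\forall s \near (0 : R)^'+, move nu s = move nu' s) -> nu = nu'.
Proof.
move=> H; apply: val_inj.
exact: dart_germ_inj (position_bnd nu) (position_bnd nu') H.
Qed.

End Darts.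

(** * Local structure of the path metric *)

Section PathMetric.
Variables (R : realType) (G : weighted_graph R).
Implicit Types (d : dart G) (t : R) (x y : realization G).

Lemma edge_path_cat x y z s s' :
  edge_path x s y -> edge_path y s' z -> edge_path x (s ++ s') z.
Proof.
elim: s x => [|[[d a] b] s IH] x /=; first by move=> ->.
by move=> [Ha Hb Hx Hs] Hs'; split => //; apply: IH.
Qed.

Lemma edge_path1 d a b : 0 <= a <= dlen d -> 0 <= b <= dlen d ->
  edge_path (pt d a) [:: (d, a, b)] (pt d b).
Proof. by move=> Ha Hb; split. Qed.

Lemma edge_path_dart d : edge_path (inl (dtail d)) [:: (d, 0, dlen d)] (inl (dhead d)).
Proof.
by rewrite -pt_tail -pt_head; apply: edge_path1; rewrite lexx ltW ?dlen_gt0.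
Qed.

Lemma edge_path_vertices (u v : vertex G) :
  exists s, edge_path (inl u : realization G) s (inl v).
Proof.
have /connectP[p] := graph_connected u v.
elim: p u => [|w p IH] u /=; first by move=> _ ->; exists [::].
move=> /andP[uw wp] vE; have [s Hs] := IH w wp vE.
move/existsP: uw => [e /orP[]] /andP[/eqP eu /eqP ew].
- have := edge_path_dart (e, true); rewrite [dtail _]eu [dhead _]ew => H.
  by eexists; apply: edge_path_cat H Hs.
- have := edge_path_dart (e, false); rewrite [dtail _]ew [dhead _]eu => H.
  by eexists; apply: edge_path_cat H Hs.
Qed.

(** Without connectedness the infimum defining the path metric could be that of
    the empty set, that is 0, and no lower bound would hold. *)
Lemma edge_path_exists x y : exists s, edge_path x s y.
Proof.
have to_vertex (z : realization G) : exists v s s',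
    edge_path z s (inl v) /\ edge_path (inl v) s' z.
  have [[v ->]|[d [t [Ht ->]]]] := realization_pt z.
    by exists v, [::], [::].
  exists (dtail d); rewrite -pt_tail; exists [:: (d, t, 0)], [:: (d, 0, t)].
  have td : 0 <= t <= dlen d by lra.
  have zd : 0 <= (0 : R) <= dlen d by lra.
  by split; [apply: (edge_path1 td zd) | apply: (edge_path1 zd td)].
have [u [s [_ [Hs _]]]] := to_vertex x; have [v [_ [s' [_ Hs']]]] := to_vertex y.
have [s'' Hs''] := edge_path_vertices u v.
by eexists; exact: (edge_path_cat Hs (edge_path_cat Hs'' Hs')).
Qed.

Lemma pathdist_le_segment d a b : 0 <= a <= dlen d -> 0 <= b <= dlen d ->
  pathdist (pt d a) (pt d b) <= `|b - a|.
Proof.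
move=> Ha Hb; apply: ge_inf.
  by exists 0 => L [s _ ->]; apply: sumr_ge0 => p _; apply: normr_ge0.
by exists [:: (d, a, b)]; [exact: edge_path1 | rewrite big_seq1].
Qed.

(** The variation of [phi] along a chain of segments is at most the length of
    the chain.  All lower bounds on the path metric come from here, through a
    suitable [phi]. *)
Lemma lipschitz_le_pathdist (phi : realization G -> R) :
  (forall d a b, 0 <= a <= dlen d -> 0 <= b <= dlen d ->
     phi (pt d a) - phi (pt d b) <= `|b - a|) ->
  forall x y, `|phi x - phi y| <= pathdist x y.
Proof.
move=> lip x y; apply: lb_le_inf.
  by have [s Hs] := edge_path_exists x y; eexists; exists s.
move=> _ [s Hs ->]; elim: s x Hs => [|[[d a] b] s IH] x /=.
  by move=> ->; rewrite subrr normr0 big_nil.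
move=> [Ha Hb <- /IH]; rewrite big_cons /=.
have := lip d a b Ha Hb; have := lip d b a Hb Ha; rewrite distrC !ler_norml; lra.
Qed.

(** A bump of slopes 1 and -1 on the interval of radius [w] around the point of
    coordinate [c] of [d]. *)
Definition tent d c w y : R :=
  if y is inr p then
    if tag p == d.1 then Num.max 0 (w - `|dart_coord d (val (tagged p)) - c|)
    else 0
  else 0.

Section Tent.
Variables (d : dart G) (c w : R).
Hypotheses (w0 : 0 <= w) (cw : 0 <= c - w) (wc : c + w <= dlen d).

Lemma tent_pt t : 0 <= t <= dlen d -> tent d c w (pt d t) = Num.max 0 (w - `|t - c|).
Proof.
move=> /andP[t0 tl]; move: t0; rewrite le_eqVlt => /predU1P[<-|t0].
  rewrite pt_tail /= max_l // sub0r normrN ger0_norm; move: w0 cw; lra.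
move: tl; rewrite le_eqVlt => /predU1P[->|tl].
  rewrite pt_head /= max_l // ger0_norm; move: w0 wc; lra.
have H : 0 < dart_coord d t < len d.1 by apply: dart_coord_bnd; rewrite t0.
by rewrite (pt_inner H) /= eqxx dart_coordK.
Qed.

Lemma tent_pt_drev t : 0 <= t <= dlen d ->
  tent d c w (pt (drev d) t) = Num.max 0 (w - `|dlen d - t - c|).
Proof. by move=> Ht; rewrite -pt_drevB // tent_pt //; lra. Qed.

Lemma tent_pt_other d' t : d'.1 != d.1 -> tent d c w (pt d' t) = 0.
Proof.
by move=> nd; rewrite /pt; case: insubP => //= u _ _; rewrite (negPf nd).
Qed.

Lemma tent_le_pathdist x y : `|tent d c w x - tent d c w y| <= pathdist x y.
Proof.
apply: lipschitz_le_pathdist => d' a b Ha Hb.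
have lip (p q : R) : Num.max 0 (w - `|p - c|) - Num.max 0 (w - `|q - c|) <= `|q - p|.
  have := ler_normD (q - p) (p - c); rewrite addrA subrK.
  have := normr_ge0 (q - p).
  case: (lerP 0 (w - `|p - c|)); case: (lerP 0 (w - `|q - c|)); lra.
have [|nd] := eqVneq d'.1 d.1; last first.
  by rewrite !tent_pt_other // subrr normr_ge0.
move=> /esym/dart_eqVrev[] dE; subst d'; rewrite /dlen /= in Ha Hb.
  by rewrite !tent_pt.
rewrite !tent_pt_drev //; have := lip (dlen d - a) (dlen d - b).
by rewrite (_ : dlen d - b - (dlen d - a) = a - b) 1?(distrC a) //; ring.
Qed.

End Tent.

End PathMetric.

(** * Branches at a point, and isometries *)

Section LocalStructure.
Variables (R : realType) (G : weighted_graph R).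
Implicit Types (d : dart G) (t : R) (x y : realization G).

(** The tent whose left foot is [x] grows with slope 1 along [nu], which bounds
    the distance from below. *)
Lemma move_pathdist x (nu : tangent x) rho s :
  position x (val nu) + 2 * rho <= dlen (val nu) -> 0 < s < rho ->
  pathdist x (move nu s) = s.
Proof.
move=> Hrho Hs; have Hp := position_bnd nu; have xE := pt_position nu.
rewrite /move -{1}xE; set d := val nu in Hrho Hp *; set p := position x d in Hrho Hp *.
have Hps : 0 <= p + s <= dlen d by lra.
have Hp' : 0 <= p <= dlen d by lra.
apply/eqP; rewrite eq_le; apply/andP; split.
  by have := pathdist_le_segment Hp' Hps; rewrite addrAC subrr add0r gtr0_norm; lra.
have [rho0 c1 c2] : [/\ 0 <= rho, 0 <= p + rho - rho & p + rho + rho <= dlen d].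
  by split; lra.
have := tent_le_pathdist rho0 c1 c2 (pt d p) (pt d (p + s)).
rewrite !tent_pt // (_ : p + s - (p + rho) = - (rho - s)); last ring.
rewrite (_ : p - (p + rho) = - rho); last ring.
by rewrite distrC !normrN !gtr0_norm ?subKr ?subrr ?maxxx ?max_r ?subr0; lra.
Qed.

Lemma min_len : exists2 m : R, 0 < m & forall e : edge G, m <= len e.
Proof.
suff [m m0 mP] : exists2 m : R, 0 < m & forall e, e \in enum (edge G) -> m <= len e.
  by exists m => // e; apply: mP; rewrite mem_enum.
elim: (enum _) => [|e l [m m0 mP]]; first by exists 1.
exists (Num.min m (len e)); first by rewrite lt_min m0 len_gt0.
move=> e'; rewrite in_cons => /predU1P[->|/mP H]; rewrite ge_min ?lexx ?orbT //.
by rewrite H.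
Qed.

(** Distance to [v], cut off at [rho]; when [rho] is at most all edge lengths it
    can be read on each edge from the values at the two ends. *)
Definition vertex_dist (v : vertex G) rho y : R :=
  let c w := if w == v then 0 else rho in
  match y with
  | inl w => c w
  | inr p => Num.min rho (Num.min (c (source (tag p)) + val (tagged p))
                (c (target (tag p)) + len (tag p) - val (tagged p)))
  end.

Lemma vertex_dist_le_pathdist v rho x y : 0 <= rho ->
  (forall e : edge G, rho <= len e) ->
  `|vertex_dist v rho x - vertex_dist v rho y| <= pathdist x y.
Proof.
move=> rho0 rhoP; apply: lipschitz_le_pathdist => d a b Ha Hb.
pose c w := if w == v then 0 else rho.
have cP w : 0 <= c w <= rho by rewrite /c; case: ifP; rewrite rho0 lexx.
have vE t : 0 <= t <= dlen d -> vertex_dist v rho (pt d t) =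
    Num.min rho (Num.min (c (dtail d) + t) (c (dhead d) + dlen d - t)).
  have [ct ch] := (cP (dtail d), cP (dhead d)); have dl := rhoP d.1.
  rewrite -/(dlen d) in dl.
  move=> /andP[t0 tl]; move: t0; rewrite le_eqVlt => /predU1P[<-|t0].
    rewrite pt_tail /= -/(c _) addr0 subr0.
    by rewrite (@min_l _ _ (c (dtail d))) ?min_r //; lra.
  move: tl; rewrite le_eqVlt => /predU1P[->|tl].
    rewrite pt_head /= -/(c _) addrK.
    by rewrite (@min_r _ _ (_ + _)) ?min_r //; lra.
  have H : 0 < dart_coord d t < len d.1 by apply: dart_coord_bnd; rewrite t0.
  rewrite (pt_inner H) /= -!/(c _) /dart_coord /dtail /dhead /dlen; case: d.2 => //.
  congr Num.min; rewrite minC; congr Num.min; ring.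
rewrite !vE //.
have minB (p q p' q' k : R) :
    p - p' <= k -> q - q' <= k -> Num.min p q - Num.min p' q' <= k.
  by move=> *; case: (leP p q); case: (leP p' q'); lra.
have ab := ler_norm (b - a); have ba := ler_norm (a - b); rewrite distrC in ba.
by do !apply: (@minB); rewrite ?subrr ?normr_ge0 //; lra.
Qed.

Lemma move_vertex (v : vertex G) d t : dtail d = v ->
  exists nu : tangent (inl v : realization G), move nu t = pt d t.
Proof.
move=> dv; have L : leaves (inl v : realization G) d by apply/eqP.
by exists (exist _ d L); rewrite /move /= add0r.
Qed.

(** Where the distance to [v] is not cut off, the point lies on an edge at
    [v], near the corresponding end. *)
Lemma vertex_ball (v : vertex G) rho y : 0 < rho ->
  (forall e : edge G, rho <= len e) -> y != inl v -> pathdist (inl v) y < rho ->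
  exists (nu : tangent (inl v : realization G)) (s : R), 0 < s < rho /\ y = move nu s.
Proof.
move=> rho0 rhoP yv Hy.
have := @vertex_dist_le_pathdist v rho (inl v) y (ltW rho0) rhoP.
rewrite /= eqxx sub0r normrN => dy.
have {Hy} {}dy : vertex_dist v rho y < rho.
  by apply: le_lt_trans (ler_norm _) (le_lt_trans dy Hy).
case: y yv dy => [w|[e [t Ht]]] /= yv.
  by case: (w =P v) yv => [->|_]; rewrite ?eqxx ?ltxx.
have H : 0 < dart_coord (e, true) t < len e by [].
have -> : inr (existT _ e (exist _ t Ht)) = pt (e, true) t :> realization G.
  by rewrite (pt_inner (d := (e, true)) H) (bool_irrelevance H Ht).
rewrite !gt_min ltxx /= => /orP[].
- case: eqP => [ev|_] Hs; last by exfalso; move: Hs; lra.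
  have [nu nuE] := @move_vertex v (e, true) t ev.
  by exists nu, t; split=> //; move: Ht Hs; lra.
- case: eqP => [ev|_] Hs; last by exfalso; move: Hs Ht; lra.
  have [nu nuE] := @move_vertex v (e, false) (len e - t) ev.
  exists nu, (len e - t); split; first by move: Ht Hs; lra.
  rewrite nuE -[(e, false)]/(drev (e, true)) -[len e]/(dlen (e, true)) pt_drev //.
  by rewrite /dlen /=; lra.
Qed.

(** The tent centred at the point vanishes outside the interval of radius [rho],
    so a point outside this interval is at distance at least [rho]. *)
Lemma edge_ball d t rho y : 0 < rho -> 0 < t - rho -> t + rho < dlen d ->
  y != pt d t -> pathdist (pt d t) y < rho ->
  exists (nu : tangent (pt d t)) (s : R), 0 < s < rho /\ y = move nu s.
Proof.
move=> rho0 rt tr yt Hy.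
have tentE := tent_pt (ltW rho0) (ltW rt) (ltW tr).
have := tent_le_pathdist (ltW rho0) (ltW rt) (ltW tr) (pt d t) y.
rewrite tentE; last lra.
rewrite subrr normr0 subr0 max_r ?(ltW rho0) // => dy.
have {Hy} {}dy : 0 < tent d t rho y by have := ler_norm (rho - tent d t rho y); lra.
have [u Hu yE] : exists2 u, 0 <= u <= dlen d & y = pt d u.
  case: y dy {yt} => [w|[e [u Hu]]]; rewrite /= ?ltxx //.
  case: eqP => [ed|]; rewrite ?ltxx // => _; subst e.
  have H : 0 < dart_coord d (dart_coord d u) < len d.1 by rewrite dart_coordK.
  exists (dart_coord d u).
    by move: Hu; rewrite /dart_coord /dlen; case: d.2; lra.
  rewrite (pt_inner H); congr (inr (existT _ d.1 _)); apply: val_inj => /=.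
  by rewrite dart_coordK.
move: dy; rewrite yE tentE //.
rewrite lt_max ltxx /= subr_gt0 ltr_norml => dy.
have ut : u != t by apply: contra_neq yt => <-.
have [nu nuE pE] := @pt_tangent _ _ d t ltac:(lra).
have Ht' : 0 <= dlen d - t < dlen (drev d) by rewrite (_ : dlen (drev d) = dlen d) //; lra.
have [nu' nuE' pE'] := pt_tangent Ht'.
move: nu' nuE' pE'; rewrite pt_drev; last lra.
move=> nu' nuE' pE' {tentE}.
case/lt_total/orP: ut => [lut|ltu]; [exists nu', (t - u) | exists nu, (u - t)].
- split; first lra.
  rewrite /move nuE' pE' addrA subrK pt_drev //.
- split; first lra.
  by rewrite /move nuE pE addrC subrK.
Qed.

Lemma tangent_inner d t (nu : tangent (pt d t)) : 0 < t < dlen d ->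
  (val nu = d /\ position (pt d t) (val nu) = t) \/
  (val nu = drev d /\ position (pt d t) (val nu) = dlen d - t).
Proof.
move=> Ht; case: nu => d' /=.
have H : 0 < dart_coord d t < len d.1 by apply: dart_coord_bnd.
rewrite (pt_inner H) /= => /eqP /esym/dart_eqVrev[]->.
  by left; split=> //; exact: (dart_coordK d t).
right; split=> //; rewrite /dart_coord /dlen /=.
by case: d.2 => //=; rewrite opprB addrC subrK.
Qed.

Lemma pathdistxx x : pathdist x x <= 0.
Proof.
apply: ge_inf.
  by exists 0 => L [s _ ->]; apply: sumr_ge0 => p _; apply: normr_ge0.
by exists [::] => //; rewrite big_nil.
Qed.

(** A small ball is a star with one branch for each tangent vector.  The
    distance between points on two branches is bounded below by [s] instead of
    its actual value [s + s'], but this bound exceeds [s - s'], which suffices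
    to tell pairs on different branches from pairs on the same branch. *)
Lemma tangent_branches x : exists2 rho : R, 0 < rho & [/\
  forall nu : tangent x, position x (val nu) + 2 * rho <= dlen (val nu),
  forall (nu nu' : tangent x) s s', nu != nu' -> 0 < s < rho -> 0 < s' < rho ->
    s <= pathdist (move nu s) (move nu' s') &
  forall y, 0 < pathdist x y < rho ->
    exists (nu : tangent x) (s : R), 0 < s < rho /\ y = move nu s].
Proof.
(* The only tangent vectors whose branches share an edge are opposite darts:
   the two ends of a loop at a vertex, or the two directions at an inner point.
   The two alternatives for [sum] are these two cases. *)
have [rho rho0 [room apart ball]] : exists2 rho : R, 0 < rho & [/\
  forall nu : tangent x, position x (val nu) + 2 * rho <= dlen (val nu),
  forall nu nu' : tangent x, val nu' = drev (val nu) ->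
    let sum := position x (val nu) + position x (val nu') in
    sum + 3 * rho <= dlen (val nu) \/ dlen (val nu) <= sum &
  forall y, 0 < pathdist x y < rho ->
    exists (nu : tangent x) (s : R), 0 < s < rho /\ y = move nu s].
  have neq y r : 0 < pathdist x y < r -> y != x.
    by move=> /andP[+ _]; apply: contraTneq => ->; rewrite -leNgt pathdistxx.
  case: (realization_pt x) neq => [[v ->]|[d [t [Ht ->]]]] neq.
    have [m m0 mP] := @min_len.
    exists (m / 4); first lra; split=> [nu|nu nu' _|y Hy].
    - by have := mP (val nu).1; rewrite /dlen /=; lra.
    - by left; have := mP (val nu).1; rewrite /dlen /=; lra.
    - apply: vertex_ball (neq _ _ Hy) _; first lra; last by case/andP: Hy.
      by move=> e; have := mP e; lra.
  pose m := Num.min t (dlen d - t).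
  have m0 : 0 < m by rewrite /m lt_min; apply/andP; split; lra.
  have mt : m <= t by rewrite /m ge_min lexx.
  have mdt : m <= dlen d - t by rewrite /m ge_min lexx orbT.
  have dl' : dlen (drev d) = dlen d by [].
  exists (m / 3); first lra; split=> [nu|nu nu'|y Hy].
  - by have [] := tangent_inner nu Ht => -[-> ->]; rewrite ?dl'; lra.
  - have [] := tangent_inner nu Ht => -[-> ->];
    have [] := tangent_inner nu' Ht => -[-> ->] E; rewrite ?dl'; try by right; lra.
      by move/esym/eqP: E; rewrite (negPf (drev_neq d)).
    by move/esym/eqP: E; rewrite (negPf (drev_neq _)).
  - by apply: edge_ball (neq _ _ Hy) _; try lra; case/andP: Hy.
exists rho => //; split=> // nu nu' s s' nn' Hs Hs'.
have Hp := position_bnd nu; have Hp' := position_bnd nu'.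
have {room} [room room'] := (room nu, room nu').
have {}apart := apart nu nu'.
have {nn'} : val nu != val nu' by rewrite val_eqE.
rewrite /move; move: (val nu) (val nu') apart Hp Hp' room room' => d d'.
move: (position x d) (position x d') => p p' apart Hp Hp' room room' dd'.
have [rho1 c1 c2] : [/\ 0 <= rho, 0 <= p + rho - rho & p + rho + rho <= dlen d].
  by split; lra.
(* The tent on the branch of [nu] with foot [x] has value [s] at the first point
   and vanishes on the branch of [nu']. *)
apply: le_trans (tent_le_pathdist rho1 c1 c2 _ _).
rewrite tent_pt //; last lra.
rewrite (_ : p + s - (p + rho) = - (rho - s)); last ring.
rewrite normrN (@gtr0_norm _ (rho - s)) ?subKr; last lra.
have -> : tent d (p + rho) rho (pt d' (p' + s')) = 0.
  have [|nd] := eqVneq d'.1 d.1; last by rewrite tent_pt_other.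
  move=> /esym/dart_eqVrev[] dE; first by rewrite dE eqxx in dd'.
  have dl' : dlen d' = dlen d by rewrite dE.
  rewrite dE tent_pt_drev //; last by rewrite -dl'; lra.
  apply/max_l; rewrite subr_le0 ler_normr.
  by case: (apart dE) => ?; apply/orP; [left|right]; lra.
by rewrite subr0 max_r ?ger0_norm; lra.
Qed.

End LocalStructure.

(** The image of the point at distance [s] along [mu] lies at distance [s] on
    some branch at [phi x].  This branch is the one reached for [s = m / 2]:
    otherwise the image points for [m / 2] and [s] would be at distance at least
    [m / 2], whereas they are at distance at most [m / 2 - s]. *)
Lemma isometry_tangent (R : realType) (G1 G2 : weighted_graph R)
  (phi : realization G1 -> realization G2) :
  (forall x y, pathdist (phi x) (phi y) = pathdist x y) ->
  forall (x : realization G1) (mu : tangent x), exists nu : tangent (phi x),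
    \forall s \near (0 : R)^'+, phi (move mu s) = move nu s.
Proof.
move=> iso x mu.
have [rho rho0 [room _ _]] := tangent_branches x.
have [rho' rho0' [room' apart ball]] := tangent_branches (phi x).
pose m := Num.min rho rho'.
have m0 : 0 < m by rewrite /m lt_min rho0.
have mr : m <= rho by rewrite /m ge_min lexx.
have mr' : m <= rho' by rewrite /m ge_min lexx orbT.
have branch s : 0 < s < m -> exists nu : tangent (phi x), phi (move mu s) = move nu s.
  move=> Hs; have dE : pathdist (phi x) (phi (move mu s)) = s.
    by rewrite iso; apply: move_pathdist (room mu) _; lra.
  have [nu [s' [Hs' E]]] := ball (phi (move mu s)) ltac:(rewrite dE; lra).
  by exists nu; rewrite E -(move_pathdist (room' nu) Hs') -E dE.
have [nu nuE] := branch (m / 2) ltac:(lra).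
exists nu; apply/near_right0P; exists (m / 2); first lra.
move=> s Hs; have [nu' nu'E] := branch s ltac:(lra).
have [->//|nn'] := eqVneq nu nu'.
have := apart _ _ (m / 2) s nn' ltac:(lra) ltac:(lra).
rewrite -nuE -nu'E iso => far; exfalso; move: far.
have Hp := position_bnd mu; have Hr := room mu.
have := @pathdist_le_segment _ _ (val mu) (position x (val mu) + m / 2)
  (position x (val mu) + s) ltac:(lra) ltac:(lra).
rewrite -!/(move mu _) opprD addrACA subrr add0r distrC gtr0_norm; lra.
Qed.

(** * Darts of one realization running along darts of another *)

Section RunsAlong.
Variables (R : realType) (G1 G2 : weighted_graph R).
Variable phi : realization G1 -> realization G2.
Implicit Types (d : dart G1) (h : dart G2) (t : R).

Definition runs_along d t h : Prop := exists2 c, 0 <= c < dlen h &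
  \forall s \near (0 : R)^'+, phi (pt d (t + s)) = pt h (c + s).

Lemma runs_along_ex d t : (forall x y, pathdist (phi x) (phi y) = pathdist x y) ->
  0 <= t < dlen d -> exists h, runs_along d t h.
Proof.
move=> iso Ht; have [mu muE pE] := pt_tangent Ht.
have [nu nuE] := isometry_tangent iso mu; exists (val nu).
exists (position (phi (pt d t)) (val nu)); first exact: position_bnd.
by apply: filterS nuE => s; rewrite /move muE pE.
Qed.

Lemma runs_along_inj d t h h' : runs_along d t h -> runs_along d t h' -> h = h'.
Proof.
move=> [c Hc H] [c' Hc' H']; apply: dart_germ_inj Hc Hc' _.
by apply: filterS2 H H' => s <- <-.
Qed.

(** The segment on which [d] follows [h] can be read in both directions. *)
Lemma runs_along_near d t h : 0 <= t < dlen d -> runs_along d t h ->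
  \forall e \near (0 : R)^'+,
    runs_along d (t + e) h /\ runs_along (drev d) (dlen d - (t + e)) (drev h).
Proof.
move=> Ht [c Hc /near_right0P[w w0 wP]].
pose m := Num.min w (Num.min (dlen d - t) (dlen h - c)).
have m0 : 0 < m by rewrite /m !lt_min; apply/and3P; split; lra.
have mw : m <= w by rewrite /m ge_min lexx.
have md : m <= dlen d - t by rewrite /m !ge_min lexx !orbT.
have mh : m <= dlen h - c by rewrite /m !ge_min lexx !orbT.
apply/near_right0P; exists m => // e He; split.
  exists (c + e); first lra.
  apply/near_right0P; exists (m - e); first lra.
  by move=> s Hs; rewrite -!addrA wP //; lra.
exists (dlen h - (c + e)); first by rewrite (_ : dlen (drev h) = dlen h) //; lra.
apply/near_right0P; exists e; first lra.
move=> s Hs; rewrite (_ : dlen d - (t + e) + s = dlen d - (t + (e - s))); last ring.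
rewrite (_ : dlen h - (c + e) + s = dlen h - (c + (e - s))); last ring.
by rewrite !pt_drev ?wP //; lra.
Qed.

End RunsAlong.

(** * Slopes of piecewise affine functions *)

Lemma near_affine_inj (R : realType) (a : R) (k k' : int) :
  (\forall s \near (0 : R)^'+, a + k%:~R * s = a + k'%:~R * s) -> k = k'.
Proof.
move=> /near_right0P[w w0 /(_ (w / 2))] H.
have /H/addrI/mulIf E : 0 < w / 2 < w by lra.
by apply: (@intr_inj R); apply: E; rewrite gt_eqF //; lra.
Qed.

Definition affine_right (R : realType) (q : R -> R) (t : R) (k : int) : Prop :=
  \forall s \near (0 : R)^'+, q (t + s) = q t + k%:~R * s.

Definition right_slope (R : realType) (q : R -> R) (t : R) : int :=
  xget 0 [set k | affine_right q t k].

Lemma right_slopeE (R : realType) (q : R -> R) t k :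
  affine_right q t k -> right_slope q t = k.
Proof.
move=> qk; have : exists k', [set k' | affine_right q t k'] k' by exists k.
move=> /(xgetPex 0) /= qk'; apply: (@near_affine_inj _ (q t)).
by apply: filterS2 qk qk' => s <- <-.
Qed.

Lemma affine_right_near (R : realType) (q : R -> R) t k : affine_right q t k ->
  \forall e \near (0 : R)^'+, affine_right q (t + e) k.
Proof.
move=> /near_right0P[w w0 wP]; apply/near_right0P; exists w => // e He.
apply/near_right0P; exists (w - e); first lra.
by move=> s Hs; rewrite -addrA !wP; [ring|lra|lra].
Qed.

Lemma affine_left_near (R : realType) (q : R -> R) t (k : int) :
  (\forall s \near (0 : R)^'+, q (t - s) = q t + k%:~R * s) ->
  \forall e \near (0 : R)^'+, affine_right q (t - e) (- k).
Proof.
move=> /near_right0P[w w0 wP]; apply/near_right0P; exists w => // e He.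
apply/near_right0P; exists e; first lra.
move=> s Hs; rewrite (_ : t - e + s = t - (e - s)); last ring.
by rewrite !wP ?mulrNz; [ring|lra|lra].
Qed.

Lemma near_no_break (R : realType) (breaks : seq R) (p : R) :
  \forall s \near (0 : R)^'+, forall c, c \in breaks -> ~~ (p < c < p + s).
Proof.
elim: breaks => [|b l IH]; first by apply: nearW.
have Hb : \forall s \near (0 : R)^'+, ~~ (p < b < p + s).
  have [bp|pb] := leP b p; first by apply: nearW => s; apply/negP; lra.
  apply/near_right0P; exists (b - p); first lra.
  by move=> s Hs; apply/negP; lra.
by apply: filterS2 IH Hb => s Hl Hs c; rewrite in_cons => /predU1P[->|/Hl].
Qed.

Lemma slopeP (R : realType) (G : weighted_graph R) (f : realization G -> R)
    (x : realization G) (nu : tangent x) : Defs.Rat f ->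
  \forall s \near (0 : R)^'+, f (move nu s) = f x + (slope f nu)%:~R * s.
Proof.
move=> ratf; suff /(xgetPex 0) : exists k : int, [set k : int |
  \forall s \near (0 : R)^'+, f (move nu s) = f x + k%:~R * s] k by [].
have Hp := position_bnd nu; have xE := pt_position nu.
set d := val nu in Hp xE *; set p := position x d in Hp xE *.
have [breaks bP] := ratf d.
have /near_right0P[w w0 wP] := near_no_break breaks p.
pose m := Num.min (w / 2) (dlen d - p).
have m0 : 0 < m by rewrite /m lt_min; apply/andP; split; lra.
have mw : m <= w / 2 by rewrite /m ge_min lexx.
have md : m <= dlen d - p by rewrite /m ge_min lexx orbT.
have [k kP] := bP p (p + m) ltac:(lra) ltac:(lra) ltac:(lra) (wP m ltac:(lra)).
exists k; apply/near_right0P; exists m => // s Hs.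
rewrite /move -/d -/p kP; last lra.
by rewrite xE addrAC subrr add0r.
Qed.

(** * Tangent vectors and divisors read in a model *)

Lemma distinct_points_divisor (R : realType) (G : weighted_graph R)
    (s : seq (realization G)) : uniq s ->
  exists E : divisor G, [/\ effective E, Defs.degree E = (size s)%:Z
    & forall x, x \in s -> E x = 1].
Proof.
move=> us; pose A := [fset x in s]%fset.
pose E : divisor G := [fsfun x in A => 1%Z | 0%Z].
have EE x : E x = if x \in s then 1 else 0 by rewrite fsfunE !inE.
exists E; split=> [x||x xs]; [by rewrite EE; case: ifP| |by rewrite EE xs].
have -> : Defs.degree E = \sum_(x <- A) 1.
  have -> : A = finsupp E.
    by apply/fsetP => x; rewrite mem_finsupp EE !inE; case: (x \in s).
  rewrite /Defs.degree; apply: eq_big_seq => x.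
  by rewrite mem_finsupp EE; case: (x \in s); rewrite ?eqxx.
have sA : size A = size s.
  by rewrite -[in RHS](undup_id us); have := card_fseq s; rewrite cardfE.
by rewrite big_const_seq count_predT sA iter_addr_0 natz.
Qed.

Section Models.
Variables (R : realType) (Gamma : weighted_graph R) (G : model Gamma).
Implicit Types (d : dart G) (t : R) (x : realization Gamma).

Lemma of_graph_isometry x y : pathdist (of_graph G x) (of_graph G y) = pathdist x y.
Proof. by rewrite -to_graph_isometry !of_graphK. Qed.

(** [points_along] with a free base point: the forward and the backward tangent
    vector at a point of a dart are indexed by [pt d t] and by
    [pt (drev d) (dlen d - t)], which are equal but not convertible. *)
Definition along x (nu : tangent x) d t : Prop :=
  \forall s \near (0 : R)^'+, to_graph (pt d (t + s)) = move nu s.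

Lemma along_ex x d t : 0 <= t < dlen d -> x = to_graph (pt d t) ->
  exists nu : tangent x, along nu d t.
Proof.
move=> Ht ->; have [mu muE pE] := pt_tangent Ht.
have [nu nuP] := isometry_tangent (@to_graph_isometry _ _ G) mu; exists nu.
by apply: filterS nuP => s <-; rewrite /move muE pE.
Qed.

(** A point inside an edge of one model has valence 2 in every model: its
    tangent vectors are carried by the isometry to the two directions of the
    edge. *)
Lemma tangent_along x d t (nu nu' : tangent x) : 0 < t < dlen d ->
  x = to_graph (pt d t) -> along nu d t -> along nu' (drev d) (dlen d - t) ->
  nu' != nu /\ forall kappa : tangent x, kappa = nu \/ kappa = nu'.
Proof.
move=> Ht xE nuP nuP'; split.
  apply/eqP => E; rewrite E in nuP'.
  have : d = drev d.
    apply: (@dart_germ_inj _ _ _ t _ (dlen d - t)); [lra| |].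
      by rewrite (_ : dlen (drev d) = dlen d) //; lra.
    apply: filterS2 nuP nuP' => s <-.
    by move=> /(can_inj (@to_graphK _ _ G)) ->.
  by move/esym/eqP; rewrite (negPf (drev_neq d)).
move=> kappa.
have [mu muP] := isometry_tangent of_graph_isometry kappa.
have {}muP : \forall s \near (0 : R)^'+, move kappa s = to_graph (move mu s).
  by apply: filterS muP => s <-; rewrite of_graphK.
have ofx : of_graph G x = pt d t by rewrite xE to_graphK.
move: mu muP; rewrite ofx => mu muP.
have [] := tangent_inner mu Ht => -[muE]; rewrite muE => pE; [left|right];
  apply: tangent_germ_inj.
  by apply: filterS2 muP nuP => s -> <-; rewrite /move muE pE.
by apply: filterS2 muP nuP' => s -> <-; rewrite /move muE pE.
Qed.

Lemma div_along (f : realization Gamma -> R) x d t (nu nu' : tangent x) :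
  0 < t < dlen d -> x = to_graph (pt d t) ->
  along nu d t -> along nu' (drev d) (dlen d - t) ->
  Defs.div f x = - (slope f nu + slope f nu').
Proof.
move=> Ht xE nuP nuP'; have [nn' all2] := tangent_along Ht xE nuP nuP'.
rewrite /Defs.div (bigD1 nu) //= (bigD1 nu') //= big1 ?addr0 // => kappa.
by case: (all2 kappa) => ->; rewrite eqxx ?andbF.
Qed.

End Models.

(** * Functions of the series along a dart *)

Section SlopeStructure.
Variables (R : realType) (Gamma : weighted_graph R) (r : nat).
Variables (D : divisor Gamma) (S : slope_structure Gamma r) (G : model Gamma).
Hypothesis D_supp : forall x : realization Gamma, D x != 0 ->
  exists v : vertex G, x = to_graph (inl v : realization G).
Local Notation H := (ss_model S).
Implicit Types (d : dart G) (h : dart H) (t : R) (f : realization Gamma -> R).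

Definition ss_coord (x : realization G) : realization H := of_graph H (to_graph x).

Lemma ss_coord_isometry x y : pathdist (ss_coord x) (ss_coord y) = pathdist x y.
Proof. by rewrite /ss_coord of_graph_isometry to_graph_isometry. Qed.

(** The tangent vector that [slope_at] picks is parallel to [nu], hence lies on
    the dart [h] of the slope structure followed by [d]. *)
Lemma slope_at_along x (nu : tangent x) d t h i :
  along nu d t -> runs_along ss_coord d t h -> slope_at S nu i = ss_slope h i.
Proof.
move=> nuP [c Hc hP]; rewrite /slope_at; case: pickP => [mu /asboolP muP|none].
  suff -> : val mu = h by [].
  apply: dart_germ_inj (position_bnd mu) Hc _.
  near=> s.
  have E1 : to_graph (move mu s) = move nu s by near: s.
  have E2 : to_graph (pt d (t + s)) = move nu s by near: s.
  have E3 : ss_coord (pt d (t + s)) = pt h (c + s) by near: s.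
  by rewrite -E3 /ss_coord E2 -E1 to_graphK.
have [mu muP] := isometry_tangent (of_graph_isometry H) nu.
have /asboolP := none mu; case.
by apply: filterS muP => s <-; rewrite of_graphK.
Unshelve. all: by end_near. Qed.

Definition edge_fun f d t : R := f (to_graph (pt d t)).

Lemma D_inner d t : 0 < t < dlen d -> D (to_graph (pt d t)) = 0.
Proof.
move=> Ht; apply/eqP; apply/negP => /negP /D_supp[v].
move=> /(can_inj (@to_graphK _ _ G)).
by rewrite (pt_inner (dart_coord_bnd Ht)).
Qed.

Lemma edge_slope f d t h : RatDS S D f -> 0 <= t < dlen d ->
  runs_along ss_coord d t h ->
  [/\ affine_right (edge_fun f d) t (right_slope (edge_fun f d) t),
      forall nu : tangent (to_graph (pt d t)), along nu d t ->
        slope f nu = right_slope (edge_fun f d) t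
    & exists i, right_slope (edge_fun f d) t = ss_slope h i].
Proof.
move=> [ratf comp _] Ht hP; have [nu nuP] := along_ex Ht erefl.
have aff : forall nu : tangent (to_graph (pt d t)), along nu d t ->
    affine_right (edge_fun f d) t (slope f nu).
  move=> nu1 nuP1; apply: filterS2 (slopeP nu1 ratf) nuP1 => s E1 E2.
  by rewrite /edge_fun E2.
have eqs nu1 (P1 : along nu1 d t) := right_slopeE (aff nu1 P1).
split; first by rewrite (eqs nu nuP); exact: aff.
  by move=> nu1 /eqs.
have [/(_ nu)[i iE] _] := comp (to_graph (pt d t)).
by exists i; rewrite (eqs nu) // iE; apply: slope_at_along nuP hP.
Qed.

Lemma edge_slope_right f d t : RatDS S D f -> 0 <= t < dlen d ->
  \forall e \near (0 : R)^'+,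
    right_slope (edge_fun f d) (t + e) = right_slope (edge_fun f d) t.
Proof.
move=> fP Ht; have [h hP] := runs_along_ex ss_coord_isometry Ht.
have [aff _ _] := edge_slope fP Ht hP.
by apply: filterS (affine_right_near aff) => e /right_slopeE.
Qed.

(** With forward slope k and backward slope k' at the point, div(f) is -(k + k')
    there, and the slope of the function just before the point is -k'. *)
Lemma edge_slope_left f d t : RatDS S D f -> 0 < t < dlen d ->
  \forall e \near (0 : R)^'+, right_slope (edge_fun f d) (t - e) =
    right_slope (edge_fun f d) t + Defs.div f (to_graph (pt d t)).
Proof.
move=> fP Ht; have Ht' : 0 <= t < dlen d by lra.
have Ht'' : 0 <= dlen d - t < dlen (drev d).
  by rewrite (_ : dlen (drev d) = dlen d) //; lra.
have [h hP] := runs_along_ex ss_coord_isometry Ht'.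
have [_ nuE _] := edge_slope fP Ht' hP.
have [nu nuP] := along_ex Ht' erefl.
have [|nu' nuP'] := @along_ex _ _ _ (to_graph (pt d t)) _ _ Ht''.
  by rewrite pt_drev //; lra.
rewrite (div_along f Ht erefl nuP nuP') (nuE nu nuP) opprD addNKr.
have ratf : Defs.Rat f by case: fP.
suff : \forall e \near (0 : R)^'+,
    affine_right (edge_fun f d) (t - e) (- slope f nu').
  by apply: filterS => e /right_slopeE.
apply: affine_left_near.
have small : \forall e \near (0 : R)^'+, e < t.
  by apply/near_right0P; exists t; [lra | move=> s /andP[]].
near=> s; rewrite /edge_fun; have st : 0 < s < t.
  by apply/andP; split; near: s => //; exact: nbhs_right_gt.
rewrite -pt_drev; last lra.
rewrite (_ : dlen d - (t - s) = dlen d - t + s); last ring.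
have -> : to_graph (pt (drev d) (dlen d - t + s)) = move nu' s by near: s.
by near: s; exact: slopeP.
Unshelve. all: by end_near. Qed.

Lemma div_inner_ge0 f d t : RatDS S D f -> 0 < t < dlen d ->
  0 <= Defs.div f (to_graph (pt d t)).
Proof.
move=> [_ _ fD] Ht.
by have := fD (to_graph (pt d t)); rewrite D_inner // add0r.
Qed.

Lemma edge_slope_nonincreasing f d t t' : RatDS S D f ->
  0 <= t -> t <= t' -> t' < dlen d ->
  right_slope (edge_fun f d) t' <= right_slope (edge_fun f d) t.
Proof.
move=> fP; apply: locally_nonincreasing => {}t Ht.
  by apply: filterS (edge_slope_right fP Ht) => e ->.
apply: filterS (edge_slope_left fP Ht) => e ->.
by rewrite lerDl div_inner_ge0.
Qed.

(** The slope drops at each of the [n] points [t + m * eta], while it stays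
    among the [r + 1] slopes of [h]. *)
Lemma slope_index_ge f d t h delta eta n : RatDS S D f ->
  0 <= t -> t + delta <= dlen d ->
  (forall u, 0 <= u < delta -> runs_along ss_coord d (t + u) h) ->
  0 < eta -> n%:R * eta < delta ->
  (forall m, (0 < m <= n)%N ->
     1 <= Defs.div f (to_graph (pt d (t + m%:R * eta)))) ->
  exists2 i, right_slope (edge_fun f d) t = ss_slope h i & (n <= i)%N.
Proof.
move=> fP t0 td hP eta0 nd fE.
have mn m : (m <= n)%N -> 0 <= m%:R * eta <= n%:R * eta.
  by move=> mn; rewrite mulr_ge0 ?ler_wpM2r ?ler_nat //= ltW.
pose v k := right_slope (edge_fun f d) (t + k%:R * eta).
have -> : right_slope (edge_fun f d) t = v 0%N by rewrite /v mul0r addr0.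
apply: index_of_descent; first exact: ss_slope_incr.
  move=> k /mn Hk; have Ht : 0 <= t + k%:R * eta < dlen d by lra.
  by have [] := edge_slope fP Ht (hP (k%:R * eta) ltac:(lra)).
move=> k kn; have Hk := mn _ kn; have Hk' := mn _ (ltnW kn).
have kS : k.+1%:R * eta = k%:R * eta + eta by rewrite -natr1 mulrDl mul1r.
have Ht : 0 < t + k.+1%:R * eta < dlen d by lra.
have /near_right0P[w w0 wP] := edge_slope_left fP Ht.
pose e := Num.min (w / 2) eta.
have e0 : 0 < e by rewrite /e lt_min eta0 andbT; lra.
have ew : e <= w / 2 by rewrite /e ge_min lexx.
have ee : e <= eta by rewrite /e ge_min lexx orbT.
have := wP e ltac:(lra).
have := @edge_slope_nonincreasing f d (t + k%:R * eta) (t + k.+1%:R * eta - e) fP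
  ltac:(lra) ltac:(lra) ltac:(lra).
rewrite -/(v k) -/(v k.+1) => le1 E; rewrite E in le1.
by apply: lt_le_trans le1; rewrite ltrDl (lt_le_trans ltr01 (fE k.+1 kn)).
Qed.

End SlopeStructure.

(** * The inequality at an interior point, and monotonicity *)

Section Monotone.
Variables (R : realType) (Gamma : weighted_graph R) (r : nat).
Variables (D : divisor Gamma) (S : slope_structure Gamma r) (G : model Gamma).
Hypothesis DS : crude_linear_series S D.
Hypothesis D_supp : forall x : realization Gamma, D x != 0 ->
  exists v : vertex G, x = to_graph (inl v : realization G).
Local Notation H := (ss_model S).
Local Notation runs := (runs_along (ss_coord S (G := G))).
Implicit Types (d : dart G) (h : dart H) (t : R).

Lemma runs_along_interval d t h : 0 <= t < dlen d -> runs d t h ->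
  exists2 w, 0 < w & forall u, 0 <= u < w -> runs d (t + u) h.
Proof.
move=> Ht hP; have /near_right0P[w w0 wP] := runs_along_near Ht hP.
exists w => // u /andP[]; rewrite le_eqVlt => /predU1P[<-|u0] uw.
  by rewrite addr0.
by have [] := wP u ltac:(lra).
Qed.

(** [k = c] is skipped, which leaves [r] points: [c] before and [r - c] after
    the point of coordinate [t]. *)
Lemma section_through_spaced_points d t eta c : (c <= r)%N -> 0 < eta ->
  r%:R * eta < t -> t + r%:R * eta < dlen d ->
  exists2 f, RatDS S D f & forall k, (k <= r)%N -> k != c ->
    1 <= Defs.div f (to_graph (pt d (t + (k%:R - c%:R) * eta))).
Proof.
move=> cr eta0 tl tr.
pose P k := to_graph (pt d (t + (k%:R - c%:R) * eta)).
have Pbnd k : (k <= r)%N -> 0 < t + (k%:R - c%:R) * eta < dlen d.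
  have bnd m : (m <= r)%N -> 0 <= m%:R * eta <= r%:R * eta.
    by move=> mr; rewrite mulr_ge0 ?ler_wpM2r ?ler_nat //= ltW.
  by move=> /bnd kb; have cb := bnd c cr; rewrite mulrBl; lra.
pose s := [seq P k | k <- rem c (iota 0 r.+1)].
have mem_ind k : (k \in rem c (iota 0 r.+1)) = (k != c) && (k <= r)%N.
  by rewrite mem_rem_uniq ?iota_uniq // inE mem_iota add0n ltnS.
have us : uniq s.
  rewrite map_inj_in_uniq ?rem_uniq ?iota_uniq // => k k'.
  rewrite !mem_ind => /andP[_ kr] /andP[_ kr'] /(can_inj (@to_graphK _ _ G)).
  move=> /(pt_inj (Pbnd k kr) (Pbnd k' kr'))[_ /(can_inj (dart_coordK d))].
  by move=> /addrI /(mulIf (lt0r_neq0 eta0)) /addIr /eqP; rewrite eqr_nat => /eqP.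
have ss : size s = r by rewrite size_map size_rem ?size_iota // mem_iota add0n ltnS.
have [E [E0 Er E1]] := distinct_points_divisor us.
have [f fP fE] := DS E0 (etrans Er (congr1 Posz ss)).
exists f => // k kr kc; have Pks : P k \in s by apply: map_f; rewrite mem_ind kc.
have [_] := fE (P k).
by rewrite (D_inner D_supp (Pbnd k kr)) (E1 _ Pks) add0r subr_ge0.
Qed.

(** The core inequality: [j] of the [r] points force the forward slope up to
    index [j], and the other [r - j] force the backward slope up to index
    [r - j]; the sum of these two slopes of [f] is at most 0 because div(f) is
    nonnegative at the point. *)
Lemma opposite_slopes_le d t h h' (j : 'I_r.+1) : 0 < t < dlen d ->
  runs d t h -> runs (drev d) (dlen d - t) h' ->
  ss_slope h j + ss_slope h' (rev_ord j) <= 0.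
Proof.
move=> Ht hP hP'.
have dl' : dlen (drev d) = dlen d by [].
have Ht1 : 0 <= t < dlen d by lra.
have Ht2 : 0 <= dlen d - t < dlen (drev d) by rewrite dl'; lra.
have [w w0 wP] := runs_along_interval Ht1 hP.
have [w' w0' wP'] := runs_along_interval Ht2 hP'.
have [delta [delta0 dw dw' dt dt']] : exists delta,
    [/\ 0 < delta, delta <= w, delta <= w', delta <= t & delta <= dlen d - t].
  exists (Num.min (Num.min w w') (Num.min t (dlen d - t))).
  rewrite !lt_min !ge_min !lexx !orbT w0 w0' /=; split=> //.
  by apply/andP; split; lra.
have [eta eta0 etar] : exists2 eta, 0 < eta & r%:R * eta < delta.
  exists (delta / r.+1%:R); first by rewrite divr_gt0 // ltr0n.
  by rewrite mulrCA gtr_pMr // ltr_pdivrMr ?ltr0n // mul1r ltr_nat.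
have eta_lt n : (n <= r)%N -> 0 <= n%:R * eta < delta.
  move=> nr; rewrite mulr_ge0 ?(ltW eta0) //=; apply: le_lt_trans etar.
  by rewrite ler_wpM2r ?ler_nat // ltW.
pose c := (r - j)%N.
have cr : (c <= r)%N by rewrite leq_subr.
have jr : (j <= r)%N by rewrite -ltnS.
have [f fP fE] := section_through_spaced_points cr eta0 (lt_le_trans etar dt)
  (ltac:(lra) : t + r%:R * eta < dlen d).
have [i iE ij] : exists2 i, right_slope (edge_fun f d) t = ss_slope h i & (j <= i)%N.
  apply: (slope_index_ge D_supp fP _ _ (delta := delta) _ eta0) => [||u Hu||m].
  - by case/andP: Ht1.
  - by lra.
  - by apply: wP; lra.
  - by case/andP: (eta_lt j jr).
  - move=> /andP[m0 mj].
    have cm : (c + m <= r)%N by rewrite -[X in (_ <= X)%N](subnK jr) leq_add2l.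
    have cm' : (c + m)%N != c by rewrite -[X in _ != X]addn0 eqn_add2l -lt0n.
    by have := fE (c + m)%N cm cm'; rewrite natrD addrAC subrr add0r.
have [i' iE' ij'] :
    exists2 i, right_slope (edge_fun f (drev d)) (dlen d - t) = ss_slope h' i & (c <= i)%N.
  apply: (slope_index_ge D_supp fP _ _ (delta := delta) _ eta0) => [||u Hu||m].
  - by case/andP: Ht2.
  - by rewrite dl'; lra.
  - by apply: wP'; lra.
  - by case/andP: (eta_lt c cr).
  - move=> /andP[m0 mc].
    have cm : (c - m <= r)%N by apply: leq_trans (leq_subr _ _) cr.
    have cm' : (c - m)%N != c by rewrite -[X in _ != X]subn0 eqn_sub2lE // -lt0n.
    have := fE (c - m)%N cm cm'.
    rewrite natrB // addrAC subrr add0r mulNr -pt_drev; last first.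
      by have := eta_lt m (leq_trans mc cr); lra.
    by rewrite opprB addrA addrAC.
have [nu nuP] := along_ex Ht1 erefl.
have [|nu' nuP'] := @along_ex _ _ _ (to_graph (pt d t)) _ _ Ht2.
  by rewrite pt_drev //; lra.
have [_ nuE _] := edge_slope fP Ht1 hP.
have nuE' : slope f nu' = right_slope (edge_fun f (drev d)) (dlen d - t).
  have [_ + _] := edge_slope fP Ht2 hP'; move: nu' nuP'.
  by rewrite pt_drev; [move=> nu' nuP' /(_ nu' nuP') | lra].
have := div_inner_ge0 D_supp fP Ht.
rewrite (div_along f Ht erefl nuP nuP') (nuE nu nuP) nuE' iE iE'.
have mono (g : dart H) (a b : 'I_r.+1) : (a <= b)%N -> ss_slope g a <= ss_slope g b.
  by rewrite leq_eqVlt => /predU1P[/val_inj->//|/ss_slope_incr/ltW].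
have jc : (rev_ord j <= i')%N by rewrite /= subSS.
by rewrite oppr_ge0; apply: le_trans; apply: lerD; apply: mono.
Qed.

(** The [j]-th prescribed slope along [d] as a function of the coordinate alone;
    [slope_at] cannot be this function, as its tangent vector has a type that
    depends on the point. *)
Definition forward_slope d (j : 'I_r.+1) t : int :=
  xget 0 [set k | exists2 h, runs d t h & k = ss_slope h j].

Lemma forward_slopeE d j t h : runs d t h -> forward_slope d j t = ss_slope h j.
Proof.
move=> hP.
have : exists k, [set k | exists2 h, runs d t h & k = ss_slope h j] k.
  by exists (ss_slope h j), h.
by rewrite /forward_slope => /(xgetPex 0)[h' h'P ->]; rewrite (runs_along_inj h'P hP).
Qed.

Lemma forward_slope_right d j t : 0 <= t < dlen d ->
  \forall e \near (0 : R)^'+, forward_slope d j (t + e) = forward_slope d j t.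
Proof.
move=> Ht; have [h hP] := runs_along_ex (ss_coord_isometry S (G := G)) Ht.
rewrite (forward_slopeE j hP); apply: filterS (runs_along_near Ht hP) => e [he _].
exact: forward_slopeE.
Qed.

(** The slopes just before the point are those of [drev h'], where [h'] leaves
    the point backwards, and [ss_slope_rev] turns the core inequality into a
    comparison of [h] with [drev h']. *)
Lemma forward_slope_left d j t : 0 < t < dlen d ->
  \forall e \near (0 : R)^'+, forward_slope d j t <= forward_slope d j (t - e).
Proof.
move=> Ht; have Ht1 : 0 <= t < dlen d by lra.
have Ht2 : 0 <= dlen d - t < dlen (drev d).
  by rewrite (_ : dlen (drev d) = dlen d) //; lra.
have [h hP] := runs_along_ex (ss_coord_isometry S (G := G)) Ht1.
have [h' hP'] := runs_along_ex (ss_coord_isometry S (G := G)) Ht2.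
rewrite (forward_slopeE j hP).
apply: filterS (runs_along_near Ht2 hP') => e [_].
rewrite drevK (_ : dlen (drev d) - (dlen d - t + e) = t - e); last first.
  by rewrite (_ : dlen (drev d) = dlen d) //; ring.
move=> /(forward_slopeE j) ->.
have := opposite_slopes_le j Ht hP hP'.
have := ss_slope_rev (drev h') j; rewrite drevK; lia.
Qed.

Lemma forward_slope_nonincreasing d j t t' : 0 <= t -> t <= t' -> t' < dlen d ->
  forward_slope d j t' <= forward_slope d j t.
Proof.
apply: locally_nonincreasing => {}t Ht; last exact: forward_slope_left.
by apply: filterS (forward_slope_right j Ht) => e ->.
Qed.

Lemma slope_at_forward d t (nu : tangent (to_graph (pt d t))) j :
  0 <= t < dlen d -> points_along nu -> slope_at S nu j = forward_slope d j t.
Proof.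
move=> Ht nuP; have [h hP] := runs_along_ex (ss_coord_isometry S (G := G)) Ht.
by rewrite (forward_slopeE j hP); exact: slope_at_along nuP hP.
Qed.

Lemma slope_at_nonincreasing d t t' (nu : tangent (to_graph (pt d t)))
    (nu' : tangent (to_graph (pt d t'))) j :
  0 <= t -> t <= t' -> t' < dlen d -> points_along nu -> points_along nu' ->
  slope_at S nu' j <= slope_at S nu j.
Proof.
move=> t0 tt' t'd nuP nuP'; rewrite !slope_at_forward //; try lra.
exact: forward_slope_nonincreasing.
Qed.

End Monotone.

Theorem proposition4p3 (R : realType) (Gamma : weighted_graph R) (r : nat)
  (D : divisor Gamma) (S : slope_structure Gamma r)
  (DS : crude_linear_series S D)
  (G : model Gamma)
  (D_supp : forall x : realization Gamma, D x != 0 ->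
     exists v : vertex G, x = to_graph (inl v : realization G))
  (e : dart G) :
  (forall (t : R) (nu : tangent (to_graph (pt e t))),
     0 <= t < dlen e -> points_along nu ->
     \forall eps \near (0 : R)^'+,
       forall nu' : tangent (to_graph (pt e (t + eps))),
         points_along nu' ->
         forall j : 'I_r.+1, slope_at S nu' j <= slope_at S nu j) /\
  (forall (t t' : R) (nu : tangent (to_graph (pt e t)))
     (nu' : tangent (to_graph (pt e t'))),
     0 <= t -> t < t' -> t' < dlen e ->
     points_along nu -> points_along nu' ->
     forall j : 'I_r.+1, slope_at S nu' j <= slope_at S nu j).
Proof.
split=> [t nu Ht nuP|t t' nu nu' t0 tt' t'e nuP nuP' j]; last first.
  by apply: (slope_at_nonincreasing DS D_supp) => //; lra.
apply/near_right0P; exists (dlen e - t); first lra.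
by move=> eps Heps nu' nuP' j; apply: (slope_at_nonincreasing DS D_supp) => //; lra.
Qed.
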